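(* Let $i, j, u, v \in \mathbb{Z}$. Then $$\sum_{w=0}^{\ell-1} (w-u, i-u) (w-v, j-v) = k( \delta_{i,j} \delta_{u, v} - \delta_{i, u} \delta_{j, v}) + \sum_{w=0}^{\ell-1} (w-v, u-v) (w-j, i-j),$$ where $\delta_{s,t}=1$ if $s\equiv t\pmod \ell$ and $\delta_{s,t}=0$ otherwise.
   Context: Let $q$ be a power of an odd prime, $\ell$ a positive divisor of $q-1$, $k = \frac{q-1}{\ell}$, $g$ a fixed generator of $\mathbb{F}_q^{*}$, and $K$ the subgroup of $\mathbb{F}_q^*$ consisting of all $\ell$-th powers of nonzero elements, so $|K|=k$. For integers $i,j$ the cyclotomic number $(i,j)$ is $(i,j) = \left| (1 + g^i K) \cap g^j K \right|$; it depends only on $i,j$ modulo $\ell$. *)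

(* Defs.v *)
From mathcomp Require Import all_boot all_order all_algebra.
From mathcomp Require Import all_fingroup all_solvable.

Set Implicit Arguments.
Unset Strict Implicit.
Unset Printing Implicit Defensive.

Import GRing.Theory Num.Theory.
Local Open Scope ring_scope.

Definition lpowers (F : finFieldType) (l : nat) : {set F} :=
  [set x ^+ l | x in [set x : F | x != 0]].

(* The exponent [i] is a (possibly negative) integer. *)
Definition cyclotomic_class (F : finFieldType) (l : nat) (g : F) (i : int)
    : {set F} :=
  [set g ^ i * x | x in lpowers F l].

Definition cyclotomic_number (F : finFieldType) (l : nat) (g : F) (i j : int)
    : nat :=
  #|[set 1 + x | x in cyclotomic_class l g i] :&: cyclotomic_class l g j|.

Definition delta_mod (l : nat) (s t : int) : int :=
  if (s == t %[mod l])%Z then 1 else 0.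

(* Main.v *)
(** Write [C_i] for the coset [g^i K], and let [N_y(u, i)] be the number of
    [a] in [C_u] with [a + y] in [C_i].  Scaling and double counting show that
    [N_y(u, i) = (w - u, i - u)] whenever [y] is in [C_w], so [k] times the
    left-hand side is the sum of [N_y(u, i) N_y(v, j)] over [y != 0].  Summed
    over all [y], these products count the quadruples [(a, b, c, d)] in
    [C_u * C_v * C_i * C_j] with [c - a = d - b].  This equation is the same as
    [a - b = c - d], which is the one counted by the right-hand side.  The term
    [y = 0], to be removed, is [k^2 delta_(i,u) delta_(j,v)] on the left and
    [k^2 delta_(i,j) delta_(u,v)] on the right. *)
Require Import Defs.
From mathcomp Require Import all_boot all_order all_algebra.
From mathcomp Require Import all_fingroup all_solvable.
From mathcomp Require Import ring.

Set Implicit Arguments.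
Unset Strict Implicit.
Unset Printing Implicit Defensive.

Import GRing.Theory Num.Theory.
Local Open Scope ring_scope.

(** [N_y(u, i)] is the case where [A] and [B] are the classes of [u] and [i]. Arbitrary subsets are
    allowed because the exchange identity uses only addition. *)
Definition shift_count (V : finZmodType) (A B : {set V}) (y : V) : nat :=
  #|[set a in A | a + y \in B]|.

Lemma shift_countE (V : finZmodType) (A B : {set V}) (y : V) :
  shift_count A B y = (\sum_(a in A) \sum_(b in B) (a + y == b)%R)%N.
Proof.
rewrite /shift_count -sum1_card.
under eq_bigl => a do rewrite inE.
rewrite big_mkcondr; apply: eq_bigr => a _ /=.
case: ifP => [aB|aNB].
  rewrite (bigD1 (a + y)) //= eqxx big1 ?addn0 // => b /andP[_ nb].
  by rewrite eq_sym (negPf nb).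
rewrite big1 // => b bB; case: eqP => // ab.
by rewrite ab bB in aNB.
Qed.

(** Given [a] and [c], only [y = c - a] contributes, and then [b + y = d] becomes
    [a + d = b + c]. *)
Lemma sum_shift_countM (V : finZmodType) (A B C D : {set V}) :
  (\sum_y shift_count A C y * shift_count B D y =
   \sum_(a in A) \sum_(b in B) \sum_(c in C) \sum_(d in D)
     (a + d == b + c)%R)%N.
Proof.
under eq_bigr => y _.
  rewrite !shift_countE big_distrl /=.
  under eq_bigr => a _.
    rewrite big_distrr /=.
    under eq_bigr => b _.
      rewrite big_distrl /=.
      under eq_bigr => c _ do rewrite big_distrr /=.
      over.
    over.
  over.
rewrite exchange_big; apply: eq_bigr => a _ /=.
rewrite exchange_big; apply: eq_bigr => b _ /=.
rewrite exchange_big; apply: eq_bigr => c _ /=.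
rewrite exchange_big; apply: eq_bigr => d _ /=.
rewrite (bigD1 (c - a)) //= big1 => [|y ny].
  rewrite addn0 [a + _]addrC subrK eqxx mul1n.
  by rewrite addrA subr_eq [d + a]addrC eq_sym.
case: eqP => // ac; case/eqP: ny.
by rewrite -ac addrC addrA addNr add0r.
Qed.

Lemma sum_shift_countM_exchange (V : finZmodType) (A B C D : {set V}) :
  (\sum_y shift_count A C y * shift_count B D y =
   \sum_y shift_count B A y * shift_count D C y)%N.
Proof.
rewrite !sum_shift_countM exchange_big; apply: eq_bigr => b _ /=.
under eq_bigr => a _ do rewrite exchange_big /=.
rewrite exchange_big; apply: eq_bigr => d _ /=.
apply: eq_bigr => a _; apply: eq_bigr => c _.
by rewrite eq_sym [a + d]addrC [d + a]addrC.
Qed.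

Section CyclotomicClasses.
Variables (F : finFieldType) (l : nat) (g : {unit F}).
Hypotheses (l_gt0 : (0 < l)%N) (l_dvd : (l %| #|F|.-1)%N).
Hypothesis g_gen : generator [set: {unit F}] g.

Local Notation C := (cyclotomic_class l (val g)).
Local Notation cyc := (cyclotomic_number l (val g)).

Lemma generator_neq0 : val g != 0.
Proof. by rewrite -unitfE (valP g). Qed.
Local Notation g0 := generator_neq0.

Lemma generator_exprz_eq1 (n : int) : val g ^ n = 1 -> (l %| n)%Z.
Proof.
have lg : (l %| #[g]%g)%N.
  by move/eqP: g_gen l_dvd => defU; rewrite -card_finField_unit defU orderE.
have gX s : val g ^+ s = 1 -> (l %| s)%N.
  move=> gs; apply: dvdn_trans lg _; rewrite order_dvdn.
  by apply/eqP/val_inj; rewrite FinRing.val_unitX gs.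
case: n => s; first by move/gX.
rewrite NegzE -exprnN => /eqP; rewrite invr_eq1 => /eqP/gX.
by rewrite dvdzE abszN.
Qed.

Lemma generator_exprz_surj (x : F) : x != 0 -> exists n : int, x = val g ^ n.
Proof.
move=> x0; have xU : x \is a GRing.unit by rewrite unitfE.
have : FinRing.unit F xU \in <[g]>%g.
  by rewrite -(eqP g_gen) inE.
case/cycleP => n xE; exists n%:Z.
by rewrite -exprnP -FinRing.val_unitX -xE.
Qed.

Lemma cyclotomic_class_neq0 (i : int) (x : F) : x \in C i -> x != 0.
Proof.
case/imsetP=> y /imsetP[z]; rewrite inE => z0 -> ->.
by rewrite mulf_neq0 ?expf_neq0 ?expfz_neq0 ?g0.
Qed.

(** Since [l] divides the order of [g], exponents of [g] make sense modulo [l]. Questions about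
    classes thus become congruences. *)
Lemma exprz_in_class (n i : int) :
  (val g ^ n \in C i) = (n == i %[mod l])%Z.
Proof.
rewrite eqz_mod_dvd; apply/idP/idP.
  case/imsetP=> y /imsetP[z]; rewrite inE => /generator_exprz_surj[s ->] ->.
  rewrite exprnP exprz_exp => gE.
  have /generator_exprz_eq1 : val g ^ (n - (i + s * l%:Z)) = 1.
    by rewrite expfzDr ?g0 // gE -expfzDr ?g0 // -expfzDr ?g0 // subrr expr0z.
  by rewrite opprD addrA rpredBr // dvdz_mull.
(* Here [n - i = t * l], so [g ^ n] is [g ^ i] times the [l]-th power of [g ^ t]. *)
case/dvdzP=> t nE; apply/imsetP; exists ((val g ^ t) ^+ l).
  by apply: imset_f; rewrite inE expfz_neq0 ?g0.
by rewrite exprnP exprz_exp -nE -expfzDr ?g0 // addrC subrK.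
Qed.

Lemma mul_in_class (a b : int) (x y : F) :
  x \in C a -> (x * y \in C (a + b)) = (y \in C b).
Proof.
move=> xa; have [->|] := eqVneq y 0.
  rewrite mulr0; apply/idP/idP => /cyclotomic_class_neq0; by rewrite eqxx.
case/generator_exprz_surj=> t ->; move: xa (cyclotomic_class_neq0 xa).
move=> + /generator_exprz_surj[s xE]; rewrite {}xE -expfzDr ?g0 //.
rewrite !exprz_in_class => /eqP sa.
by rewrite -modzDml sa modzDml eqz_modDl.
Qed.

Lemma exprz_class (i : int) : val g ^ i \in C i.
Proof. by rewrite exprz_in_class. Qed.

Lemma mem_two_classes (i j : int) (x : F) :
  x \in C i -> (x \in C j) = (i == j %[mod l])%Z.
Proof.
move=> xi; have /generator_exprz_surj[n xE] := cyclotomic_class_neq0 xi.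
by move: xi; rewrite xE !exprz_in_class => /eqP->.
Qed.

Lemma sum_cyclotomic_class (f : F -> nat) :
  (\sum_(w < l) \sum_(y in C w) f y = \sum_(y | y != 0%R) f y)%N.
Proof.
rewrite (exchange_big_dep (fun y => y != 0)) /=; last first.
  by move=> w y _ /cyclotomic_class_neq0.
apply: eq_bigr => y /generator_exprz_surj[n ->].
have l0 : l%:Z != 0 by rewrite eqz_nat -lt0n.
have nl : (`|(n %% l)%Z| < l)%N.
  by rewrite -ltz_nat gez0_abs ?modz_ge0 // ltz_pmod.
(* The classes partition the nonzero elements: [g ^ n] lies only in the one indexed by the residue
   of [n]. *)
rewrite (big_pred1 (Ordinal nl)) // => w /=.
rewrite exprz_in_class [(w %% _)%Z]modz_small ?ltz_nat ?ltn_ord //.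
by rewrite -val_eqE /= -eqz_nat gez0_abs ?modz_ge0 // eq_sym.
Qed.

Lemma card_class_eq (i j : int) : #|C i| = #|C j|.
Proof.
suff cardE n : #|C n| = #|lpowers F l| by rewrite !cardE.
by apply: card_imset; apply: mulfI; rewrite expfz_neq0 ?g0.
Qed.

Lemma card_cyclotomic_class (i : int) : #|C i| = (#|F|.-1 %/ l)%N.
Proof.
have /= := sum_cyclotomic_class (fun=> 1%N).
under eq_bigr => w _ do rewrite sum1_card (card_class_eq w i).
rewrite sum_nat_const card_ord sum1_card => lE.
have -> : #|F|.-1 = (l * #|C i|)%N by rewrite lE -(cardC1 (0 : F)).
by rewrite mulKn.
Qed.

Lemma cyclotomic_class_gt0 (i : int) : (0 < #|C i|)%N.
Proof. by apply/card_gt0P; exists (val g ^ i); apply: exprz_class. Qed.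

(** The map [t |-> z * (t - 1)] carries the intersection defining [cyc a b] bijectively onto this
    set: [t = 1 + x] gives [y = z * x] and [z + y = z * t]. *)
Lemma cyclotomic_number_scale (a b s : int) (z : F) : z \in C s ->
  cyc a b = #|[set y in C (s + a) | z + y \in C (s + b)]|.
Proof.
move=> zs; have z0 := cyclotomic_class_neq0 zs.
have inj : injective (fun t => z * (-1 + t)) by move=> x y /(mulfI z0)/addrI.
rewrite -[LHS](card_imset _ inj); apply: eq_card => y.
have -> : y = z * (-1 + (1 + y / z)) by rewrite addKr mulrC divfK.
rewrite (mem_imset _ _ inj); move: (y / z) => {}y.
rewrite addKr !inE mul_in_class // -[X in X + z * y]mulr1 -mulrDr mul_in_class //.
by rewrite mem_imset //; apply: addrI.
Qed.

(** Scaling by an element of [C w] gives [(u - w, i - w)], whichever element is used. *)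
Lemma shift_count_scale (u i w : int) (y z : F) : y \in C w -> z \in C w ->
  shift_count (C u) (C i) y = shift_count (C u) (C i) z.
Proof.
have cE x : x \in C w -> shift_count (C u) (C i) x = cyc (u - w) (i - w).
  move=> xw; rewrite (cyclotomic_number_scale _ _ xw).
  rewrite ![w + (_ - w)]addrC !subrK.
  by apply: eq_card => a; rewrite !inE [x + a]addrC.
by move=> /cE-> /cE->.
Qed.

(** Count the pairs [(a, z)] in [C u] times [C w] with [a + z] in [C i]. Each [z] gives the same
    count as [y], each [a] gives [(w - u, i - u)] by scaling, and [C u] and [C w] have equal
    positive size, which cancels. *)
Lemma shift_count_class (u i w : int) (y : F) : y \in C w ->
  shift_count (C u) (C i) y = cyc (w - u) (i - u).
Proof.
move=> yw; apply/eqP; rewrite -(eqn_pmul2l (cyclotomic_class_gt0 w)).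
rewrite {2}(card_class_eq w u) -!sum_nat_const; apply/eqP.
under eq_bigr => z zw do rewrite (shift_count_scale _ _ yw zw) /shift_count.
under [RHS]eq_bigr => a au.
  rewrite (cyclotomic_number_scale _ _ au).
  rewrite ![u + (_ - u)]addrC !subrK -sum1_card.
  under eq_bigl => z do rewrite inE.
  rewrite big_mkcondr.
  over.
rewrite [RHS]exchange_big /=; apply: eq_bigr => z _.
rewrite -sum1_card; under eq_bigl => a do rewrite inE.
by rewrite big_mkcondr.
Qed.

(** At [y = 0] the count is the size of the intersection of two classes, which are equal or
    disjoint. *)
Lemma shift_count_class0 (u i : int) :
  (shift_count (C u) (C i) 0)%:Z = (#|F|.-1 %/ l)%N%:Z * delta_mod l i u.
Proof.
rewrite /shift_count /delta_mod eq_sym -(card_cyclotomic_class u).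
case: ifP => iu; last rewrite mulr0.
  rewrite mulr1; congr Posz; apply: eq_card => a; rewrite inE addr0.
  by case: (boolP (a \in C u)) => // /mem_two_classes->.
congr Posz; apply: eq_card0 => a; rewrite inE addr0.
by case: (boolP (a \in C u)) => // /mem_two_classes->.
Qed.

(** The factor in front is the size of [C w], so it spreads the term of [w] over all [y] in
    [C w]. *)
Lemma sum_cyclotomic_number (i j u v : int) :
  (#|F|.-1 %/ l * \sum_(w < l) cyc (w%:Z - u) (i - u) * cyc (w%:Z - v) (j - v)
   = \sum_(y | y != 0%R) shift_count (C u) (C i) y * shift_count (C v) (C j) y)%N.
Proof.
rewrite -sum_cyclotomic_class big_distrr; apply: eq_bigr => w _ /=.
rewrite -(card_cyclotomic_class w) -sum_nat_const; apply: eq_bigr => y yw.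
by rewrite !(shift_count_class _ _ yw).
Qed.

End CyclotomicClasses.

Theorem theorem4p1 (p m q : nat) (F : finFieldType)
    (p_prime : prime p) (p_odd : odd p) (m_gt0 : (0 < m)%N)
    (q_def : q = (p ^ m)%N) (card_F : #|F| = q)
    (l : nat) (l_gt0 : (0 < l)%N) (l_dvd : (l %| q - 1)%N)
    (k : nat) (k_def : k = ((q - 1) %/ l)%N)
    (g : {unit F}) (g_gen : generator [set: {unit F}] g)
    (i j u v : int) :
  let c (a b : int) : int := (cyclotomic_number l (val g) a b)%:Z in
  let d (s t : int) : int := delta_mod l s t in
  \sum_(w < l) c (w%:Z - u) (i - u) * c (w%:Z - v) (j - v) =
  k%:Z * (d i j * d u v - d i u * d j v) +
  \sum_(w < l) c (w%:Z - v) (u - v) * c (w%:Z - j) (i - j).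
Proof.
move=> c d; rewrite -card_F subn1 in l_dvd k_def.
have sumE a b s t : \sum_(w < l) c (w%:Z - s) (a - s) * c (w%:Z - t) (b - t) =
    (\sum_(w < l) cyclotomic_number l (val g) (w%:Z - s) (a - s) *
      cyclotomic_number l (val g) (w%:Z - t) (b - t))%N%:Z.
  by rewrite (big_morph Posz PoszD (erefl _)).
have k0 : k%:Z != 0.
  rewrite eqz_nat k_def -(card_cyclotomic_class l_gt0 l_dvd g_gen 0) -lt0n.
  exact: cyclotomic_class_gt0.
(* Only the two factors [k] in front of the sums are unfolded; those of the delta term stay. *)
rewrite !sumE; apply: (mulfI k0); rewrite mulrDr -!PoszM {1 4}k_def.
rewrite !sum_cyclotomic_number //.
set C := cyclotomic_class l (val g).
have := sum_shift_countM_exchange (C u) (C v) (C i) (C j).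
rewrite (bigD1 0) //= [in RHS](bigD1 0) //= => /(congr1 Posz).
rewrite !PoszD !PoszM !shift_count_class0 // -!k_def -/(d _ _).
rewrite -/(d i j) -/(d u v) -/(d j v) => /(canRL (addKr _)) ->.
ring.
Qed.
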